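(* Let $\mathbbm k$ be an algebraically closed field, $n\ge1$ with $\mathrm{char}\,\mathbbm k\nmid 2n$, $a\in\mathbb Z/n$ with $a^2\equiv1\pmod n$, $m\in\mathbb Z/n$ with $(1-a)m\equiv0$, and $G=G_{n,a,m}$, acting trivially on $\mathbbm k^\times$. Let $d_\pm=\gcd(a\pm1,n)$. Then $$\mathrm H^2(G,\mathbbm k^\times)\cong\begin{cases}0&\text{if }d_-d_+=n\text{ or }G\text{ is non-split},\\ \mathbb Z/2&\text{if }d_-d_+=2n\text{ and }G\text{ is split}.\end{cases}$$ Consequently, for a stacky curve $\mathcal C$ over $\mathbbm k$, a doubly-twisted node with stabilizer $G$ contributes this group as a direct summand of $\mathrm H^2(\mathcal C,\mathbb G_m)$; in particular $\mathrm H^2([\operatorname{Spec}\mathbbm k[x,y]/(xy)\,/\,\mu_n\rtimes\mathbb Z/2],\mathbb G_m)=\mathbb Z/2$ when $d_-d_+=2n$ (e.g. $a=-1$).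
   Context: $G_{n,a,m}$ is the group generated by $t,\sigma$ with relations $t^n=1$, $\sigma t\sigma^{-1}=t^a$, $\sigma^2=t^m$ (an extension of $\mathbb Z/2$ by $\mu_n\cong\langle t\rangle$); $G$ is split if it is isomorphic to the semidirect product $\mu_n\rtimes\mathbb Z/2$ (equivalently $\gcd(a+1,n)\mid m$). The Brauer-type group of a stacky curve $\mathcal C$ (tame, proper, geometrically integral one-dimensional DM stack with trivial generic stabilizer over algebraically closed $\mathbbm k$) is $\mathrm H^2(\mathcal C,\mathbb G_m)=\bigoplus_i\mathrm H^2(G_i,\mathbbm k^\times)$ over the singular points $p_i$ of $\mathcal C_{\mathrm{red}}$ with geometric stabilizers $G_i$ acting trivially. A doubly-twisted node is a node étale locally of the form $[\operatorname{Spec}R/G]$ with $\mu_n\subset G$ acting by $(x,y)\mapsto(\zeta_nx,\zeta_n^ay)$ and elements outside $\mu_n$ interchanging the two branches of $xy=0$. *)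

(* Defs.v *)
From HB Require Import structures.
From mathcomp Require Import all_boot all_order all_algebra all_fingroup all_solvable.
Set Implicit Arguments. Unset Strict Implicit. Unset Printing Implicit Defensive.
Import GRing.Theory.
Local Open Scope ring_scope.
Local Open Scope group_scope.

Section Cohomology.
Variables (gT : finGroupType) (F : fieldType).

Definition cocycle2 (G : {set gT}) (f : gT -> gT -> F) : Prop :=
  (forall x y, x \in G -> y \in G -> f x y != 0%R) /\
  (forall x y z, x \in G -> y \in G -> z \in G ->
     (f y z * f x (y * z)%g = f (x * y)%g z * f x y)%R).

Definition coboundary2 (G : {set gT}) (f : gT -> gT -> F) : Prop :=
  exists c : gT -> F, (forall x, x \in G -> c x != 0%R) /\
    (forall x y, x \in G -> y \in G -> f x y = (c x * c y / c (x * y)%g)%R).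

Definition cohomologous (G : {set gT}) (f g : gT -> gT -> F) : Prop :=
  coboundary2 G (fun x y => (f x y / g x y)%R).

Definition H2_trivial (G : {set gT}) : Prop :=
  forall f, cocycle2 G f -> coboundary2 G f.

(* H^2(G, F^x) has exactly two elements, i.e. is isomorphic to Z/2. *)
Definition H2_is_Z2 (G : {set gT}) : Prop :=
  exists f0, [/\ cocycle2 G f0, ~ coboundary2 G f0 &
    forall f, cocycle2 G f -> coboundary2 G f \/ cohomologous G f f0].
End Cohomology.

(* G = <t, s> with #[t] = n, s t s^-1 = t^a, s^2 = t^m, #|G| = 2n:
   G is (isomorphic to) the group G_{n,a,m} given by the presentation. *)
Definition is_Gnam (gT : finGroupType) (G : {group gT}) (t s : gT) (n a m : nat) : Prop :=
  [/\ G :=: <<[set t; s]>>, #[t] = n, s * t * s^-1 = t ^+ a, s ^+ 2 = t ^+ m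
    & #|G| = (2 * n)%N].

(* Split: the extension 1 -> mu_n = <t> -> G -> Z/2 -> 1 splits, i.e.
   G is the semidirect product <t> >< Z/2. *)
Definition Gnam_split (gT : finGroupType) (G : {group gT}) (t : gT) : Prop :=
  exists H : {group gT}, <[t]> ><| H = G.

(* Main.v *)
Require Import Defs.
From HB Require Import structures.
From mathcomp Require Import all_boot all_order all_algebra all_fingroup all_solvable.
From mathcomp Require Import ring zify.
Set Implicit Arguments. Unset Strict Implicit. Unset Printing Implicit Defensive.
Import GRing.Theory.

(* A 2-cocycle [f] with values in [k^x] is a central extension of [G] by [k^x].
   Lift [t] to [T] with [T ^+ n = 1] (using roots in [k]) and [s] to [S]; then
   [S T = w T^a S] for a scalar [w] with [w ^+ (a + 1) = w ^+ m = w ^+ n = 1].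
   Rescaling [T] by an [n]-th root of unity [eta] multiplies [w] by
   [eta ^+ (a - 1)], and these run over the [h]-th roots of unity, [h = n / d_-];
   when [w ^+ h = 1] the lifts can be chosen to satisfy the defining relations of
   [G], which splits the extension. So [f] is a coboundary iff [w ^+ h = 1].
   As [h | d_+ | 2 h], [w ^+ h = 1] or [-1]. If [d_- d_+ = n] then [h = d_+]; if
   [G] is non-split then [d_+] does not divide [m] and [gcd (d_+, m) = h]; either
   way [w ^+ h = 1]. If [d_- d_+ = 2 n] and [G] splits, an explicit cocycle has
   [w ^+ h = -1 <> 1] (as [char k <> 2]) and its class generates [H^2]. *)

Section Arithmetic.
Variables n a m : nat.
Hypothesis n_gt0 : 0 < n.

(* [a + n - 1] represents [a - 1] modulo [n] without truncated subtraction. *)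
Local Notation dm := (gcdn (a + n - 1) n).
Local Notation dp := (gcdn (a + 1) n).
Local Notation h := (n %/ dm).

Lemma dminus_gt0 : 0 < dm.
Proof. by rewrite gcdn_gt0 n_gt0 orbT. Qed.

Lemma divn_dminusK : h * dm = n.
Proof. by rewrite divnK // dvdn_gcdr. Qed.

Lemma divn_dminus_gt0 : 0 < h.
Proof. by rewrite divn_gt0 ?dminus_gt0 // dvdn_leq // dvdn_gcdr. Qed.

Lemma dvdn_divn_dminus x : n %| (a + n - 1) * x -> h %| x.
Proof.
move=> dvd_n; have : n %| dm * x by rewrite muln_gcdl dvdn_gcd dvd_n dvdn_mulr.
by rewrite -{1}divn_dminusK mulnC dvdn_pmul2l ?dminus_gt0.
Qed.

Lemma dvdn_pred_mul x : a * x = x %[mod n] -> n %| (a + n - 1) * x.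
Proof.
move=> ax; have E : (a + n - 1) * x + x = x * n + a * x by nia.
have : (a + n - 1) * x + x = 0 + x %[mod n] by rewrite E modnMDl ax add0n.
by move/eqP; rewrite eqn_modDr mod0n.
Qed.

Lemma divn_dminus_dvd_m : a * m = m %[mod n] -> h %| m.
Proof. by move/dvdn_pred_mul/dvdn_divn_dminus. Qed.

Lemma divn_dminus_dvd_dplus : a ^ 2 = 1 %[mod n] -> h %| dp.
Proof.
move=> a2; rewrite dvdn_gcd dvdn_div ?dvdn_gcdr // andbT.
apply/dvdn_divn_dminus/dvdn_pred_mul.
by rewrite mulnDr muln1 -modnDml mulnn a2 modnDml addnC.
Qed.

Lemma dplus_dvdn_double : dp %| 2 * h.
Proof.
have dvd2 : gcdn dp dm %| 2.
  have g_succ : gcdn dp dm %| a + 1 by apply: dvdn_trans (dvdn_gcdl _ _) (dvdn_gcdl _ _).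
  have g_pred : gcdn dp dm %| a + n - 1 by apply: dvdn_trans (dvdn_gcdr _ _) (dvdn_gcdl _ _).
  have g_n : gcdn dp dm %| n by apply: dvdn_trans (dvdn_gcdr _ _) (dvdn_gcdr _ _).
  have E : a + n - 1 + 2 = a + 1 + n by lia.
  by rewrite -(dvdn_addr 2 g_pred) E dvdn_add.
have : dp %| h * gcdn dp dm.
  by rewrite muln_gcdr dvdn_gcd dvdn_mull //= divn_dminusK dvdn_gcdr.
by move/dvdn_trans; apply; rewrite [2 * _]mulnC dvdn_pmul2l ?divn_dminus_gt0.
Qed.

Lemma divn_dminus_eq_dplus : dm * dp = n -> h = dp.
Proof.
by move=> E; apply/eqP; rewrite -(eqn_pmul2l dminus_gt0) E mulnC divn_dminusK.
Qed.

Lemma dplus_eq_double : dm * dp = 2 * n -> dp = 2 * h.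
Proof.
move=> E; apply/eqP; rewrite -(eqn_pmul2l dminus_gt0) E.
by rewrite mulnCA (mulnC dm) divn_dminusK.
Qed.

Lemma gcdn_dplus_m : a ^ 2 = 1 %[mod n] -> a * m = m %[mod n] ->
  ~~ (dp %| m) -> gcdn dp m = h.
Proof.
move=> a2 am dp_ndvd_m.
have h_dvd : h %| gcdn dp m by rewrite dvdn_gcd divn_dminus_dvd_dplus ?divn_dminus_dvd_m.
have [r E] := dvdnP h_dvd.
have : r %| 2.
  rewrite -(@dvdn_pmul2r h) ?divn_dminus_gt0 // -E.
  exact: dvdn_trans (dvdn_gcdl _ _) dplus_dvdn_double.
rewrite dvdn_divisors // inE /= => /orP[/eqP r1 | /orP[/eqP r2 | //]].
  by rewrite E r1 mul1n.
case/negP: dp_ndvd_m; apply: dvdn_trans dplus_dvdn_double _.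
by rewrite -r2 -E dvdn_gcdr.
Qed.
End Arithmetic.

Section RootsOfUnity.
Local Open Scope ring_scope.

Lemma expr_gcdn_eq1 (R : pzSemiRingType) (w : R) p q :
  w ^+ p = 1 -> w ^+ q = 1 -> w ^+ gcdn p q = 1.
Proof.
case: p => [|p] wp wq; first by rewrite gcd0n.
have [u _ /dvdnP [r E]] := Bezoutl q (ltn0Sn p).
have : w ^+ (gcdn p.+1 q + u * q) = 1 by rewrite E mulnC exprM wp expr1n.
by rewrite exprD mulnC exprM wq expr1n mulr1.
Qed.

Lemma expr_divn_gcdn_eq1 (R : pzSemiRingType) (eta : R) b n :
  eta ^+ n = 1 -> (eta ^+ b) ^+ (n %/ gcdn b n)%N = 1.
Proof. by move=> eta_n; rewrite -exprM muln_divCA_gcd exprM eta_n expr1n. Qed.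

Lemma mulr_expr_addn_pred (R : pzSemiRingType) (x : R) a n : (0 < n)%N ->
  x ^+ n = 1 -> x * x ^+ (a + n - 1) = x ^+ a.
Proof.
by move=> n_gt0 x_n; rewrite -exprS subn1 prednK ?addn_gt0 ?n_gt0 ?orbT // exprD x_n mulr1.
Qed.

Definition root_closed (k : fieldType) :=
  forall (N : nat) (c : k), (0 < N)%N -> exists x : k, x ^+ N = c.

Lemma closed_field_root_closed (k : closedFieldType) : root_closed k.
Proof.
move=> N c N_gt0; have /closed_rootP [x /rootP] : size ('X^N - c%:P : {poly k}) != 1%N.
  by rewrite size_XnsubC // eqSS -lt0n.
by rewrite !hornerE => /eqP; rewrite subr_eq0 => /eqP; exists x.
Qed.

Variable k : fieldType.
Hypothesis k_roots : root_closed k.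

Lemma exists_root_of_unity_expr (w : k) b n : (0 < n)%N ->
  w ^+ (n %/ gcdn b n)%N = 1 -> exists2 eta : k, eta ^+ n = 1 & eta ^+ b = w.
Proof.
move=> n_gt0 w_h; set d := gcdn b n; set h := (n %/ d)%N.
have d_gt0 : (0 < d)%N by rewrite gcdn_gt0 n_gt0 orbT.
have h_gt0 : (0 < h)%N by rewrite divn_gt0 // dvdn_leq // dvdn_gcdr.
have [v v_d] := k_roots w d_gt0.
have v_neq0 : v != 0.
  apply: contra_eq_neq w_h => v0.
  by rewrite -v_d v0 expr0n gtn_eqF // expr0n gtn_eqF // eq_sym oner_eq0.
have v_n : v ^+ n = 1 by rewrite -(divnK (dvdn_gcdr b n)) -/d -/h mulnC exprM v_d.
have [u _ /dvdnP [q Bez]] := Bezoutr b n_gt0.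
exists (v ^+ u)^-1; first by rewrite exprVn -exprM mulnC exprM v_n expr1n invr1.
have : v ^+ (d + u * b) = 1 by rewrite Bez mulnC exprM v_n expr1n.
have vub_neq0 : (v ^+ u) ^+ b != 0 by rewrite !expf_neq0.
by rewrite exprD v_d exprM exprVn => vub; apply: (mulIf vub_neq0); rewrite mulVf.
Qed.
End RootsOfUnity.

Section PresentedGroup.
Local Open Scope group_scope.
Variables (gT : finGroupType) (G : {group gT}) (t s : gT) (n a m : nat).
Hypotheses (n_gt0 : (0 < n)%N) (HG : is_Gnam G t s n a m).

Lemma mem_Gnam_t : t \in G.
Proof. by case: HG => -> *; apply: mem_gen; rewrite !inE eqxx. Qed.

Lemma mem_Gnam_s : s \in G.
Proof. by case: HG => -> *; apply: mem_gen; rewrite !inE eqxx orbT. Qed.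

Lemma order_Gnam_t : #[t] = n.
Proof. by case: HG. Qed.

Lemma expg_Gnam_t : t ^+ n = 1.
Proof. by rewrite -order_Gnam_t expg_order. Qed.

Lemma sqr_Gnam_s : s ^+ 2 = t ^+ m.
Proof. by case: HG. Qed.

Lemma mulg_Gnam_s_t : s * t = t ^+ a * s.
Proof. by case: HG => _ _ <- *; rewrite mulgKV. Qed.

Lemma mulg_Gnam_s_texp j : s * t ^+ j = t ^+ (a * j) * s.
Proof.
elim: j => [|j IHj]; first by rewrite muln0 !expg0 mulg1 mul1g.
by rewrite expgSr mulgA IHj -mulgA mulg_Gnam_s_t mulgA -expgD mulnS addnC.
Qed.

Lemma mulg_Gnam_sexp_texp e j : s ^+ e * t ^+ j = t ^+ (a ^ e * j) * s ^+ e.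
Proof.
elim: e j => [|e IHe] j; first by rewrite expn0 mul1n expg0 mulg1 mul1g.
by rewrite expgS -mulgA IHe mulgA mulg_Gnam_s_texp -mulgA -expgS expnS mulnA.
Qed.

Lemma Gnam_wordM i e j e' :
  t ^+ i * s ^+ e * (t ^+ j * s ^+ e') = t ^+ (i + a ^ e * j) * s ^+ (e + e').
Proof.
by rewrite mulgA -(mulgA _ (s ^+ e)) mulg_Gnam_sexp_texp mulgA -expgD -mulgA -expgD.
Qed.

Lemma card_Gnam : #|G| = (2 * n)%N.
Proof. by case: HG. Qed.

Lemma Gnam_s_notin_cycle : s \notin <[t]>.
Proof.
apply/negP => s_t; have : G \subset <[t]>.
  case: HG => -> *; rewrite gen_subG; apply/subsetP => x.
  by rewrite !inE => /orP[]/eqP->; rewrite ?cycle_id.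
move/subset_leq_card; rewrite card_Gnam -orderE order_Gnam_t.
by apply/negP; rewrite -ltnNge mul2n -addnn -{1}[n]addn0 ltn_add2l.
Qed.

Lemma Gnam_word_inj i j e e' : (i < n)%N -> (j < n)%N -> (e < 2)%N -> (e' < 2)%N ->
  t ^+ i * s ^+ e = t ^+ j * s ^+ e' -> i = j /\ e = e'.
Proof.
move=> i_lt j_lt e_lt e'_lt.
have texp_inj : t ^+ i = t ^+ j -> i = j.
  by move/eqP; rewrite eq_expg_mod_order order_Gnam_t !modn_small // => /eqP.
have texp_neq_s i1 j1 : t ^+ i1 <> t ^+ j1 * s.
  move=> E; case/negP: Gnam_s_notin_cycle.
  by rewrite -(mulKg (t ^+ j1) s) -E groupM ?groupV ?mem_cycle.
case: e e_lt => [|[|//]] _; case: e' e'_lt => [|[|//]] _; rewrite ?expg0 ?expg1 ?mulg1.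
- by move/texp_inj.
- by move/texp_neq_s.
- by move/esym/texp_neq_s.
- by move/mulIg/texp_inj.
Qed.

Definition Gnam_word (p : 'I_n * 'I_2) := t ^+ p.1 * s ^+ p.2.

Lemma Gnam_word_onto x : x \in G -> exists p, x = Gnam_word p.
Proof.
move=> xG; have word_inj : injective Gnam_word.
  move=> [i e] [j e'] /(Gnam_word_inj (ltn_ord _) (ltn_ord _) (ltn_ord _) (ltn_ord _)).
  by case=> /val_inj /= -> /val_inj /= ->.
have sub : Gnam_word @: setT \subset G.
  by apply/subsetP => y /imsetP [p _ ->]; rewrite groupM ?groupX ?mem_Gnam_t ?mem_Gnam_s.
have card : #|Gnam_word @: setT| = #|G|.
  by rewrite card_imset // cardsT card_prod !card_ord card_Gnam mulnC.
have /imsetP [p _ ->] : x \in Gnam_word @: setT by rewrite (subset_cardP card sub).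
by exists p.
Qed.

Definition Gnam_coords x : option ('I_n * 'I_2) := [pick p | x == Gnam_word p].
Definition texp x := if Gnam_coords x is Some p then val p.1 else 0%N.
Definition sexp x := if Gnam_coords x is Some p then val p.2 else 0%N.

Lemma Gnam_normal_form x : x \in G ->
  [/\ x = t ^+ texp x * s ^+ sexp x, (texp x < n)%N & (sexp x < 2)%N].
Proof.
case/Gnam_word_onto=> q x_q; rewrite /texp /sexp /Gnam_coords.
case: pickP => [p /eqP -> | /(_ q)]; first by split; rewrite ?ltn_ord.
by rewrite x_q eqxx.
Qed.

Lemma Gnam_coords_word i l : texp (t ^+ i * s ^+ l) = ((i + m * (l %/ 2)) %% n)%N /\
  sexp (t ^+ i * s ^+ l) = (l %% 2)%N.
Proof.
have -> : t ^+ i * s ^+ l = t ^+ ((i + m * (l %/ 2)) %% n) * s ^+ (l %% 2).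
  rewrite (expg_mod _ expg_Gnam_t) expgD {1}(divn_eq l 2) expgD mulnC expgM.
  by rewrite sqr_Gnam_s -expgM mulgA.
have xG : t ^+ ((i + m * (l %/ 2)) %% n) * s ^+ (l %% 2) \in G.
  by rewrite groupM ?groupX ?mem_Gnam_t ?mem_Gnam_s.
have [E i_lt e_lt] := Gnam_normal_form xG.
by have [] := Gnam_word_inj i_lt (ltn_pmod _ n_gt0) e_lt (ltn_pmod _ (ltn0Sn 1)) (esym E).
Qed.

Lemma cycle_Gnam_t_normal : <[t]> <| G.
Proof.
have t_sub : <[t]> \subset G by rewrite cycle_subG mem_Gnam_t.
apply: index2_normal => //.
by rewrite -divgS // card_Gnam -orderE order_Gnam_t mulnK.
Qed.

Lemma sqr_Gnam_texp_s j : (t ^+ j * s) ^+ 2 = t ^+ (j + a * j + m).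
Proof.
rewrite expgS expg1 mulgA -[t ^+ j * s * t ^+ j]mulgA mulg_Gnam_s_texp mulgA.
by rewrite -expgD -mulgA -[s * s]/(s ^+ 2) sqr_Gnam_s -expgD.
Qed.

(* A complement to [<[t]>] is generated by an involution [t ^+ j * s], whose
   square is [t ^+ ((a + 1) * j + m)]. *)
Lemma Gnam_split_of_dvdn : (gcdn (a + 1) n %| m)%N -> Gnam_split G t.
Proof.
case/dvdnP=> q m_eq; have [u _ Bez] := Bezoutr (a + 1) n_gt0.
set y := t ^+ (u * q) * s.
have y2 : y ^+ 2 = 1.
  rewrite /y sqr_Gnam_texp_s; apply/eqP; rewrite -order_dvdn order_Gnam_t.
  have -> : (u * q + a * (u * q) + m = q * (gcdn (a + 1) n + u * (a + 1)))%N.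
    by rewrite m_eq; ring.
  exact: dvdn_mull.
have y_notin : y \notin <[t]>.
  apply: contra Gnam_s_notin_cycle => y_t.
  by rewrite -(mulKg (t ^+ (u * q)) s) groupM ?groupV ?mem_cycle.
have order_y : #[y] = 2.
  have : (#[y] %| 2)%N by rewrite order_dvdn y2.
  rewrite dvdn_divisors // inE /= => /orP[/eqP o1|/orP[/eqP //|//]].
  by case/negP: y_notin; move/eqP: o1; rewrite order_eq1 => /eqP->; rewrite group1.
have yG : y \in G by rewrite groupM ?groupX ?mem_Gnam_t ?mem_Gnam_s.
have TI : <[t]> :&: <[y]> = 1.
  by rewrite setIC prime_TIg -?orderE ?order_y // cycle_subG.
have norm_y : <[y]> \subset 'N(<[t]>).
  by rewrite cycle_subG (subsetP (normal_norm cycle_Gnam_t_normal)).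
exists <[y]>%G; rewrite sdprodE //=; apply/eqP.
rewrite eqEcard mul_subG ?cycle_subG ?mem_Gnam_t //= TI_cardMg //.
by rewrite -!orderE order_y order_Gnam_t card_Gnam mulnC.
Qed.

Lemma dvdn_of_Gnam_split : Gnam_split G t -> (gcdn (a + 1) n %| m)%N.
Proof.
case=> H sdGH; have [_ mulG _ TI] := sdprodP sdGH.
have card_H : #|H| = 2.
  have := sdprod_card sdGH; rewrite -orderE order_Gnam_t card_Gnam mulnC => /eqP.
  by rewrite eqn_pmul2r // => /eqP.
have : H :!=: 1 by rewrite trivg_card1 card_H.
case/trivgPn => y yH y_neq1.
have yG : y \in G by rewrite -mulG (subsetP (mulG_subr _ _)).
have y_notin : y \notin <[t]>.
  apply: contra y_neq1 => y_t; have : y \in <[t]> :&: H by rewrite inE y_t.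
  by rewrite TI inE.
have y2 : y ^+ 2 = 1 by rewrite -card_H expg_cardG.
have [y_eq _] := Gnam_normal_form yG; case: (sexp y) y_eq => [|[|//]] y_eq _.
  by move: y_notin; rewrite y_eq expg0 mulg1 mem_cycle.
move: y2; rewrite y_eq expg1 sqr_Gnam_texp_s => /eqP; rewrite -order_dvdn order_Gnam_t.
move/(dvdn_trans (dvdn_gcdr (a + 1) n)).
have -> : (texp y + a * texp y + m = (a + 1) * texp y + m)%N by ring.
by rewrite dvdn_addr // dvdn_mulr // dvdn_gcdl.
Qed.

Lemma Gnam_splitP : reflect (Gnam_split G t) (gcdn (a + 1) n %| m)%N.
Proof. exact: (iffP idP) Gnam_split_of_dvdn dvdn_of_Gnam_split. Qed.
End PresentedGroup.

Section Cocycles.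
Local Open Scope ring_scope.
Variables (k : fieldType) (gT : finGroupType) (G : {group gT}).
Implicit Types (f g : gT -> gT -> k) (c : k).

Lemma cocycle2_1x f x : cocycle2 G f -> x \in G -> f 1%g x = f 1%g 1%g.
Proof.
case=> f_neq0 f_assoc xG; have := f_assoc 1%g 1%g x (group1 G) (group1 G) xG.
by rewrite !mul1g => /(mulfI (f_neq0 _ _ (group1 G) xG)).
Qed.

Lemma cocycle2_x1 f x : cocycle2 G f -> x \in G -> f x 1%g = f 1%g 1%g.
Proof.
case=> f_neq0 f_assoc xG; have := f_assoc x 1%g 1%g xG (group1 G) (group1 G).
by rewrite !mulg1 => /(mulIf (f_neq0 _ _ xG (group1 G))).
Qed.

Lemma cocycle2_scale c f : c != 0 -> cocycle2 G f -> cocycle2 G (fun x y => c * f x y).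
Proof.
move=> c_neq0 [f_neq0 f_assoc]; split=> [x y xG yG | x y z xG yG zG].
  by rewrite mulf_neq0 ?f_neq0.
by rewrite mulrACA f_assoc // mulrACA.
Qed.

Lemma cocycle2_normalize f : cocycle2 G f ->
  cocycle2 G (fun x y => (f 1%g 1%g)^-1 * f x y) /\ (f 1%g 1%g)^-1 * f 1%g 1%g = 1.
Proof.
move=> fC; have f11_neq0 : f 1%g 1%g != 0 by case: fC => f_neq0 _; rewrite f_neq0.
by rewrite mulVf //; split=> //; apply: cocycle2_scale; rewrite ?invr_eq0.
Qed.

Lemma cocycle2_div f g : cocycle2 G f -> cocycle2 G g ->
  cocycle2 G (fun x y => f x y / g x y).
Proof.
move=> [f_neq0 f_assoc] [g_neq0 g_assoc]; split=> [x y xG yG | x y z xG yG zG].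
  by rewrite mulf_neq0 ?invr_eq0 ?f_neq0 ?g_neq0.
by rewrite !mulf_div f_assoc // g_assoc.
Qed.

Lemma coboundary2_eq_in f g : (forall x y, x \in G -> y \in G -> f x y = g x y) ->
  coboundary2 G f -> coboundary2 G g.
Proof. by move=> fg [c [c_neq0 cE]]; exists c; split=> // x y xG yG; rewrite -fg ?cE. Qed.

Lemma coboundary2_scaleV c f : c != 0 ->
  coboundary2 G (fun x y => c * f x y) -> coboundary2 G f.
Proof.
move=> c_neq0 [b [b_neq0 bE]]; exists (fun x => c^-1 * b x).
split=> [x xG | x y xG yG]; first by rewrite mulf_neq0 ?invr_eq0 ?b_neq0.
have := b_neq0 _ (groupM xG yG); have := bE x y xG yG => E bxy_neq0.
by rewrite -(mulKf c_neq0 (f x y)) E; field; rewrite c_neq0 bxy_neq0.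
Qed.
End Cocycles.

(* [k * gT] with the product [emul] is the central extension of [G] by [k^x]
   classified by the cocycle [f]; [f 1 1 = 1] makes [eone] its unit. *)
Section ExtensionOperations.
Local Open Scope ring_scope.
Variables (k : fieldType) (gT : finGroupType) (f : gT -> gT -> k).
Implicit Types (X Y Z : k * gT) (c d : k).

Definition emul X Y : k * gT := (X.1 * Y.1 * f X.2 Y.2, (X.2 * Y.2)%g).
Definition escale c X : k * gT := (c * X.1, X.2).
Definition eone : k * gT := (1, 1%g).
Definition eexp X i := iter i (fun Y => emul Y X) eone.

Lemma mulZe c X Y : emul (escale c X) Y = escale c (emul X Y).
Proof. by rewrite /emul /escale /=; congr pair; ring. Qed.

Lemma muleZ c X Y : emul X (escale c Y) = escale c (emul X Y).
Proof. by rewrite /emul /escale /=; congr pair; ring. Qed.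

Lemma scaleeA c d X : escale c (escale d X) = escale (c * d) X.
Proof. by rewrite /escale /= mulrA. Qed.

Lemma scale1e X : escale 1 X = X.
Proof. by rewrite /escale mul1r; case: X. Qed.

Lemma escale_inj c d Z : Z.1 != 0 -> escale c Z = escale d Z -> c = d.
Proof. by move=> Z_neq0 /(congr1 fst) /= /(mulIf Z_neq0). Qed.

Lemma expeSr X i : eexp X i.+1 = emul (eexp X i) X.
Proof. by []. Qed.

Lemma expe_snd X i : (eexp X i).2 = (X.2 ^+ i)%g.
Proof. by elim: i => [|i IHi] //=; rewrite IHi expgSr. Qed.

Lemma expeZ c X i : eexp (escale c X) i = escale (c ^+ i) (eexp X i).
Proof.
elim: i => [|i IHi]; first by rewrite expr0 scale1e.
by rewrite !expeSr IHi mulZe muleZ scaleeA exprSr.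
Qed.

Lemma mem_expe (G : {group gT}) X i : X.2 \in G -> (eexp X i).2 \in G.
Proof. by move=> XG; rewrite expe_snd groupX. Qed.

Lemma mem_mule (G : {group gT}) X Y : X.2 \in G -> Y.2 \in G -> (emul X Y).2 \in G.
Proof. exact: groupM. Qed.
End ExtensionOperations.
Arguments eone {k gT}.

Ltac ext_mem := solve [repeat first [assumption | apply: mem_mule | apply: mem_expe]].
Local Hint Extern 0 (is_true (_.2 \in _)) => ext_mem : core.

Section TwistedExtension.
Local Open Scope ring_scope.
Variables (k : fieldType) (gT : finGroupType) (f : gT -> gT -> k) (G : {group gT}).
Implicit Types (X Y Z : k * gT) (c d : k).
Local Notation emul := (emul f).
Local Notation eexp := (eexp f).
Hypotheses (fC : cocycle2 G f) (f11 : f 1%g 1%g = 1) (k_roots : root_closed k).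

Let f_neq0 := proj1 fC.
Let f_assoc := proj2 fC.

Lemma muleA X Y Z : X.2 \in G -> Y.2 \in G -> Z.2 \in G ->
  emul (emul X Y) Z = emul X (emul Y Z).
Proof.
move=> XG YG ZG; rewrite /emul /= mulgA; congr pair.
transitivity (X.1 * Y.1 * Z.1 * (f (X.2 * Y.2)%g Z.2 * f X.2 Y.2)); first by ring.
by rewrite -f_assoc //; ring.
Qed.

Lemma mul1e X : X.2 \in G -> emul eone X = X.
Proof.
by move=> XG; rewrite /emul /= (cocycle2_1x fC) // f11 mul1g !mul1r mulr1; case: X XG.
Qed.

Lemma mule1 X : X.2 \in G -> emul X eone = X.
Proof. by move=> XG; rewrite /emul /= (cocycle2_x1 fC) // f11 mulg1 !mulr1; case: X XG. Qed.

Lemma mule_neq0 X Y : X.2 \in G -> Y.2 \in G -> X.1 != 0 -> Y.1 != 0 -> (emul X Y).1 != 0.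
Proof. by move=> XG YG X_neq0 Y_neq0; rewrite /= !mulf_neq0 ?f_neq0. Qed.

Lemma expe_neq0 X i : X.2 \in G -> X.1 != 0 -> (eexp X i).1 != 0.
Proof.
move=> XG X_neq0; elim: i => [|i IHi]; first exact: oner_neq0.
by rewrite expeSr mule_neq0.
Qed.

Lemma expe1 X : X.2 \in G -> eexp X 1 = X.
Proof. by move=> XG; rewrite expeSr mul1e. Qed.

Lemma expe2 X : X.2 \in G -> eexp X 2 = emul X X.
Proof. by move=> XG; rewrite expeSr expe1. Qed.

Lemma expeD X i j : X.2 \in G -> eexp X (i + j) = emul (eexp X i) (eexp X j).
Proof.
move=> XG; elim: j => [|j IHj]; first by rewrite addn0 mule1.
by rewrite addnS !expeSr IHj muleA.
Qed.

Lemma expeM X i j : X.2 \in G -> eexp X (i * j) = eexp (eexp X i) j.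
Proof.
move=> XG; elim: j => [|j IHj]; first by rewrite muln0.
by rewrite mulnS addnC expeD // IHj.
Qed.

Lemma expe1n i : eexp eone i = eone.
Proof. by elim: i => [|i IHi] //; rewrite expeSr IHi mule1 // group1. Qed.

Lemma expe_mod X N i : eexp X N = eone -> X.2 \in G -> eexp X i = eexp X (i %% N).
Proof.
move=> XN XG; rewrite {1}(divn_eq i N) expeD // mulnC expeM // XN expe1n mul1e //.
Qed.

Lemma mule_expe_conj (a : nat) S T w j : emul S T = escale w (emul (eexp T a) S) ->
  S.2 \in G -> T.2 \in G ->
  emul S (eexp T j) = escale (w ^+ j) (emul (eexp T (a * j)) S).
Proof.
move=> ST SG TG; elim: j => [|j IHj]; first by rewrite muln0 expr0 scale1e mule1 // mul1e.
rewrite expeSr -muleA // IHj mulZe muleA // ST muleZ scaleeA -exprSr.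
by rewrite -muleA // -expeD // mulnS addnC.
Qed.

Variables (t s : gT) (n a m : nat).
Hypotheses (n_gt0 : (0 < n)%N) (HG : is_Gnam G t s n a m).
Let tG := mem_Gnam_t HG.
Let sG := mem_Gnam_s HG.

Section ExactLifts.
Variables (al be : k).
Hypotheses (al_neq0 : al != 0) (be_neq0 : be != 0).
Local Notation T := (al, t).
Local Notation S := (be, s).
Hypotheses (T_n : eexp T n = eone) (ST : emul S T = emul (eexp T a) S)
  (S_2 : eexp S 2 = eexp T m).

Lemma mule_expe_S_T e j : emul (eexp S e) (eexp T j) = emul (eexp T (a ^ e * j)) (eexp S e).
Proof.
have ST1 : emul S T = escale 1 (emul (eexp T a) S) by rewrite scale1e.
elim: e j => [|e IHe] j; first by rewrite expn0 mul1n mul1e // mule1.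
rewrite expeSr muleA // (mule_expe_conj _ ST1 sG tG) expr1n scale1e.
by rewrite -muleA // IHe muleA // -expeSr expnS mulnCA mulnA.
Qed.

Lemma mule_words i e j e' :
  emul (emul (eexp T i) (eexp S e)) (emul (eexp T j) (eexp S e')) =
  emul (eexp T (i + a ^ e * j)) (eexp S (e + e')).
Proof.
rewrite muleA // -[emul (eexp S e) (emul _ _)]muleA // mule_expe_S_T.
by rewrite [emul (emul (eexp T _) (eexp S e)) _]muleA // -expeD // -muleA // -expeD.
Qed.

Definition lift x := emul (eexp T (texp t s n x)) (eexp S (sexp t s n x)).

Lemma lift_word i l : lift (t ^+ i * s ^+ l)%g = emul (eexp T i) (eexp S l).
Proof.
rewrite /lift; have [-> ->] := Gnam_coords_word n_gt0 HG i l; apply: esym.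
rewrite {1}(divn_eq l 2) expeD // mulnC expeM // S_2 -expeM // -muleA // -expeD //.
by rewrite [eexp T (i + _)](expe_mod _ T_n tG).
Qed.

Lemma liftM x y : x \in G -> y \in G -> emul (lift x) (lift y) = lift (x * y)%g.
Proof.
case/(Gnam_normal_form n_gt0 HG) => x_eq _ _; case/(Gnam_normal_form n_gt0 HG) => y_eq _ _.
by rewrite {2}x_eq {2}y_eq (Gnam_wordM HG) lift_word /lift mule_words.
Qed.

Lemma lift_snd x : x \in G -> (lift x).2 = x.
Proof. by case/(Gnam_normal_form n_gt0 HG) => x_eq _ _; rewrite /= !expe_snd -x_eq. Qed.

Lemma lift_neq0 x : (lift x).1 != 0.
Proof. by rewrite mule_neq0 ?expe_neq0. Qed.

Lemma coboundary2_of_lifts : coboundary2 G f.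
Proof.
exists (fun x => ((lift x).1)^-1); split=> [x _ | x y xG yG].
  by rewrite invr_eq0 lift_neq0.
have E : (lift x).1 * (lift y).1 * f (lift x).2 (lift y).2 = (lift (x * y)%g).1.
  exact (congr1 fst (liftM xG yG)).
rewrite !lift_snd // in E; rewrite -E invrK.
by field; rewrite !lift_neq0.
Qed.
End ExactLifts.

(* [w] depends on the choice of [al] only up to [(a - 1)]-th powers of [n]-th
   roots of unity. *)
Definition twist (w : k) := exists2 al : k, al != 0 &
  eexp (al, t) n = eone /\ emul (1, s) (al, t) = escale w (emul (eexp (al, t) a) (1, s)).

Section TwistProperties.
Variables (al w : k).
Hypotheses (al_neq0 : al != 0) (T_n : eexp (al, t) n = eone)
  (ST : emul (1, s) (al, t) = escale w (emul (eexp (al, t) a) (1, s))).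
Local Notation T := (al, t).
Local Notation S := ((1 : k), s).

Let S_neq0 : S.1 != 0. Proof. exact: oner_neq0. Qed.
Let u := (eexp S 2).1 / (eexp T m).1.

Let S_2 : eexp S 2 = escale u (eexp T m).
Proof.
rewrite /escale /u divfK ?expe_neq0 //.
by rewrite [in RHS]expe_snd -(sqr_Gnam_s HG) -(expe_snd f S 2); case: (eexp S 2).
Qed.

Let u_neq0 : u != 0.
Proof. by rewrite mulf_neq0 ?invr_eq0 ?expe_neq0. Qed.

Lemma twist_expn : w ^+ n = 1.
Proof.
have := mule_expe_conj n ST sG tG; rewrite T_n mule1 // mulnC expeM // T_n expe1n mul1e //.
by rewrite -{1}[S]scale1e => /escale_inj -> //.
Qed.

Lemma twist_exprm : (a * m = m %[mod n])%N -> w ^+ m = 1.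
Proof.
move=> am; have E : emul S (eexp S 2) = emul (eexp S 2) S by rewrite expe2 // muleA.
rewrite S_2 muleZ mulZe (mule_expe_conj _ ST sG tG) scaleeA in E.
rewrite [eexp T (a * m)](expe_mod _ T_n tG) am -(expe_mod _ T_n tG) in E.
have := escale_inj _ E; rewrite mule_neq0 ?expe_neq0 // => /(_ isT).
by rewrite -{2}[u]mulr1 => /(mulfI u_neq0).
Qed.

Lemma twist_expr_succ : (a ^ 2 = 1 %[mod n])%N -> w ^+ (a + 1) = 1.
Proof.
move=> a2; have E : emul (eexp S 2) T = emul S (emul S T) by rewrite expe2 // muleA.
rewrite S_2 mulZe -expeSr ST muleZ -muleA // (mule_expe_conj _ ST sG tG) mulZe scaleeA in E.
rewrite muleA // -expe2 // S_2 muleZ scaleeA -expeD // in E.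
have aam : (a * a + m = m.+1 %[mod n])%N by rewrite -modnDml mulnn a2 modnDml addnC addn1.
rewrite [eexp T (a * a + m)](expe_mod _ T_n tG) aam -(expe_mod _ T_n tG) in E.
have := escale_inj _ E; rewrite expe_neq0 // => /(_ isT) uw.
by apply: (mulIf u_neq0); rewrite mul1r [in RHS]uw addn1 exprS.
Qed.

(* A coboundary gives a homomorphic section [x |-> ((c x)^-1, x)]; comparing it
   with [T] and [S] yields [eta] with [eta ^+ n = 1] and [w = eta ^+ (a - 1)]. *)
Lemma twist_of_coboundary : coboundary2 G f -> w ^+ (n %/ gcdn (a + n - 1) n)%N = 1.
Proof.
case=> c [c_neq0 cE]; pose sec x := ((c x)^-1, x).
have secM x y : x \in G -> y \in G -> emul (sec x) (sec y) = sec (x * y)%g.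
  move=> xG yG; rewrite /emul /sec /= cE //; congr pair.
  by have := c_neq0 _ (groupM xG yG) => cxy_neq0; field; rewrite cxy_neq0 !c_neq0.
have sec1 : sec 1%g = eone.
  have := cE _ _ (group1 G) (group1 G); rewrite f11 mulg1 mulfK ?c_neq0 // => c1.
  by rewrite /sec -c1 invr1.
have sec_expe i : eexp (sec t) i = sec (t ^+ i)%g.
  elim: i => [|i IHi]; first by rewrite expg0 sec1.
  by rewrite expeSr IHi secM ?groupX // expgSr.
pose eta := (c t)^-1 / al; pose zeta := (c s)^-1.
have sec_t : sec t = escale eta T by rewrite /escale divfK.
have sec_s : sec s = escale zeta S by rewrite /escale mulr1.
have eta_neq0 : eta != 0 by rewrite mulf_neq0 ?invr_eq0 ?c_neq0.
have zeta_neq0 : zeta != 0 by rewrite invr_eq0 c_neq0.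
have eta_n : eta ^+ n = 1.
  have := sec_expe n; rewrite (expg_Gnam_t HG) sec1 sec_t expeZ T_n.
  by move/(congr1 fst); rewrite /= mulr1.
have rel : emul (sec s) (sec t) = emul (eexp (sec t) a) (sec s).
  by rewrite sec_expe !secM ?groupX // (mulg_Gnam_s_t HG).
rewrite sec_t sec_s mulZe muleZ ST !scaleeA expeZ mulZe muleZ scaleeA in rel.
have := escale_inj _ rel; rewrite mule_neq0 ?expe_neq0 // => /(_ isT) eta_w.
have eta_pred : eta ^+ (a + n - 1) = w.
  apply: (mulfI eta_neq0); rewrite mulr_expr_addn_pred //.
  by apply: (mulIf zeta_neq0); rewrite -eta_w -mulrA mulrC.
by rewrite -eta_pred expr_divn_gcdn_eq1.
Qed.

(* When [w = eta ^+ (a - 1)] with [eta ^+ n = 1], rescaling [T] by [eta] makes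
   [s t = t^a s] hold exactly, and rescaling [S] by a square root fixes [s^2 = t^m]. *)
Lemma coboundary2_of_twist : w ^+ (n %/ gcdn (a + n - 1) n)%N = 1 -> coboundary2 G f.
Proof.
move=> w_h.
have [eta eta_n eta_pred] := exists_root_of_unity_expr k_roots n_gt0 w_h.
have eta_neq0 : eta != 0.
  by apply: contra_eq_neq eta_n => ->; rewrite expr0n gtn_eqF // eq_sym oner_eq0.
have eta_w : eta * w = eta ^+ a by rewrite -eta_pred mulr_expr_addn_pred.
set T' := escale eta (al, t).
have T'_neq0 : T'.1 != 0 by rewrite mulf_neq0.
have T'G : T'.2 \in G by [].
have [c c_2] := k_roots ((eexp T' m).1 / (eexp (1, s) 2).1) (ltn0Sn 1).
have c_neq0 : c != 0.
  have : (eexp T' m).1 / (eexp (1, s) 2).1 != 0.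
    by rewrite mulf_neq0 ?invr_eq0 ?expe_neq0 ?oner_neq0.
  by rewrite -c_2 expf_eq0.
have S'E : ((c, s) : k * gT) = escale c (1, s) by rewrite /escale mulr1.
apply: (@coboundary2_of_lifts (eta * al) c) => //; rewrite -[(eta * al, t)]/T' ?S'E //.
- by rewrite expeZ T_n eta_n scale1e.
- rewrite /T' mulZe muleZ ST expeZ mulZe muleZ !scaleeA -eta_w; congr escale; ring.
- apply: injective_projections; first by rewrite expeZ /escale c_2 divfK ?expe_neq0 ?oner_neq0.
  by rewrite expeZ /escale !expe_snd /= (sqr_Gnam_s HG).
Qed.
End TwistProperties.

Lemma twist_exists : exists w, twist w.
Proof.
set z := (eexp (1, t) n).1.
have z_neq0 : z != 0 by rewrite expe_neq0 // oner_neq0.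
have [al al_n] := k_roots z^-1 n_gt0.
have al_neq0 : al != 0.
  by apply: contra_eq_neq al_n => ->; rewrite expr0n gtn_eqF // eq_sym invr_eq0.
have T_n : eexp (al, t) n = eone.
  rewrite -[al]mulr1 -/(escale al (1, t)) expeZ al_n /escale mulVf //.
  by rewrite expe_snd (expg_Gnam_t HG).
set X := emul (eexp (al, t) a) (1, s).
have X_neq0 : X.1 != 0 by rewrite mule_neq0 ?expe_neq0 ?oner_neq0.
exists ((emul (1, s) (al, t)).1 / X.1), al => //; split=> //.
by rewrite /escale divfK // /X /= expe_snd /= -(mulg_Gnam_s_t HG).
Qed.

Lemma twist_expr_eq1 w : (a ^ 2 = 1 %[mod n])%N -> (a * m = m %[mod n])%N ->
  twist w -> w ^+ gcdn (a + 1) n = 1 /\ w ^+ m = 1.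
Proof.
move=> a2 am [al al_neq0 [T_n ST]]; split; last exact: twist_exprm ST am.
by apply: expr_gcdn_eq1; [exact: twist_expr_succ ST a2 | exact: twist_expn ST].
Qed.

Lemma twist_coboundaryE w : twist w ->
  coboundary2 G f <-> w ^+ (n %/ gcdn (a + n - 1) n)%N = 1.
Proof.
case=> al al_neq0 [T_n ST]; split.
  exact: twist_of_coboundary al_neq0 T_n ST.
exact: coboundary2_of_twist al_neq0 T_n ST.
Qed.

End TwistedExtension.

Section TwistRatio.
Local Open Scope ring_scope.
Variables (k : fieldType) (gT : finGroupType).
Implicit Types (f g : gT -> gT -> k) (X Y : k * gT).

Definition eratio X Y : k * gT := (X.1 / Y.1, X.2).

Lemma emul_ratio f g X Y X' Y' : X.2 = Y.2 -> X'.2 = Y'.2 ->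
  emul (fun x y => f x y / g x y) (eratio X Y) (eratio X' Y') =
  eratio (emul f X X') (emul g Y Y').
Proof. by move=> XY X'Y'; rewrite /emul /eratio /= -XY -X'Y' !mulf_div. Qed.

Lemma expe_ratio f g X Y i : X.2 = Y.2 ->
  eexp (fun x y => f x y / g x y) (eratio X Y) i = eratio (eexp f X i) (eexp g Y i).
Proof.
move=> XY; elim: i => [|i IHi]; first by rewrite /eratio /= divr1.
by rewrite !expeSr IHi emul_ratio // !expe_snd XY.
Qed.

Lemma eratio_scale c d X Y : eratio (escale c X) (escale d Y) = escale (c / d) (eratio X Y).
Proof. by rewrite /eratio /escale /= invfM; congr pair; ring. Qed.

Lemma twist_div f g (t s : gT) n a w v : twist f t s n a w -> twist g t s n a v ->
  twist (fun x y => f x y / g x y) t s n a (w / v).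
Proof.
case=> al al_neq0 [T_n ST] [be be_neq0 [T'_n S'T']].
exists (al / be); first by rewrite mulf_neq0 ?invr_eq0.
have -> : ((al / be), t) = eratio (al, t) (be, t) by [].
have -> : ((1 : k), s) = eratio (1, s) (1, s) by rewrite /eratio divr1.
split; first by rewrite expe_ratio // T_n T'_n /eratio divr1.
by rewrite emul_ratio // ST S'T' eratio_scale expe_ratio // emul_ratio // !expe_snd.
Qed.
End TwistRatio.

(* The cocycle of the extension in which the lifts [T], [S] of [t], [s] satisfy
   [T ^+ n = 1], [S ^+ 2 = T ^+ m] and [S T = om T^a S], read off the set-theoretic
   section [t^i s^e |-> T^i S^e]. *)
Section ExplicitCocycle.
Local Open Scope ring_scope.
Variables (gT : finGroupType) (G : {group gT}) (t s : gT) (n a m : nat).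
Hypotheses (n_gt0 : (0 < n)%N) (HG : is_Gnam G t s n a m).
Variables (k : fieldType) (om : k).
Hypotheses (om_n : om ^+ n = 1) (om_succ : om ^+ (a + 1) = 1) (om_m : om ^+ m = 1).

Definition Gnam_cocycle x y := if sexp t s n x == 1%N then om ^+ texp t s n y else 1.

Lemma Gnam_cocycle_word i e j e' :
  Gnam_cocycle (t ^+ i * s ^+ e)%g (t ^+ j * s ^+ e')%g = if odd e then om ^+ j else 1.
Proof.
rewrite /Gnam_cocycle (proj2 (Gnam_coords_word n_gt0 HG i e)).
rewrite (proj1 (Gnam_coords_word n_gt0 HG j e')) modn2 eqb1.
by rewrite (expr_mod _ om_n) exprD exprM om_m expr1n mulr1.
Qed.

Lemma om_neq0 : om != 0.
Proof.
by apply: contra_eq_neq om_n => ->; rewrite expr0n gtn_eqF // eq_sym oner_eq0.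
Qed.

Lemma Gnam_cocycle_cocycle : cocycle2 G Gnam_cocycle.
Proof.
split=> [x y _ _ | x y z xG yG zG].
  by rewrite /Gnam_cocycle; case: ifP; rewrite ?expf_neq0 ?om_neq0 ?oner_neq0.
have [x_eq _ e_lt] := Gnam_normal_form n_gt0 HG xG.
have [y_eq _ e'_lt] := Gnam_normal_form n_gt0 HG yG.
have [z_eq _ _] := Gnam_normal_form n_gt0 HG zG.
rewrite x_eq y_eq z_eq !(Gnam_wordM HG) !Gnam_cocycle_word.
move: (sexp t s n x) (sexp t s n y) e_lt e'_lt => [|[|//]] [|[|//]] _ _ //=.
- by rewrite mul1r expn0 mul1n exprD mulrC.
- rewrite mul1r expn1 mulrC -exprD -addnA -{2}[texp t s n z]mul1n -mulnDl.
  by rewrite exprD exprM om_succ expr1n mulr1.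
Qed.

Lemma Gnam_cocycle_11 : Gnam_cocycle 1%g 1%g = 1.
Proof. by have := Gnam_cocycle_word 0 0 0 0; rewrite !expg0 mulg1. Qed.

Lemma twist_Gnam_cocycle : twist Gnam_cocycle t s n a om.
Proof.
have cocycle_t i y : Gnam_cocycle (t ^+ i)%g y = 1.
  rewrite -[(t ^+ i)%g]mulg1 -(expg0 s) /Gnam_cocycle.
  by rewrite (proj2 (Gnam_coords_word n_gt0 HG i 0)).
have expe_t i : eexp Gnam_cocycle (1, t) i = (1, (t ^+ i)%g).
  by elim: i => [|i IHi] //; rewrite expeSr IHi /emul /= cocycle_t !mulr1 expgSr.
exists 1; first exact: oner_neq0.
split; first by rewrite expe_t (expg_Gnam_t HG).
rewrite expe_t /emul /escale /= cocycle_t -(mulg_Gnam_s_t HG).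
have := Gnam_cocycle_word 0 1 1 0; rewrite expg0 mul1g !expg1 mulg1 /= => ->.
by rewrite !mul1r !mulr1.
Qed.
End ExplicitCocycle.

Section GnamCohomology.
Local Open Scope ring_scope.
Variables (gT : finGroupType) (G : {group gT}) (t s : gT) (n a m : nat).
Hypotheses (n_gt0 : (0 < n)%N) (HG : is_Gnam G t s n a m).
Hypotheses (a2 : (a ^ 2 = 1 %[mod n])%N) (am : (a * m = m %[mod n])%N).
Variable k : fieldType.
Hypothesis k_roots : root_closed k.
Local Notation dp := (gcdn (a + 1) n).
Local Notation h := (n %/ gcdn (a + n - 1) n)%N.

Lemma Gnam_class_invariant f : cocycle2 G f -> exists w : k,
  [/\ w ^+ dp = 1, w ^+ m = 1, w ^+ h = 1 -> coboundary2 G f &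
      forall g v, cocycle2 G g -> g 1%g 1%g = 1 -> twist g t s n a v ->
        (w / v) ^+ h = 1 -> cohomologous G f g].
Proof.
move=> fC; have [nC n11] := cocycle2_normalize fC.
have f11_neq0 : f 1%g 1%g != 0 by case: fC => f_neq0 _; rewrite f_neq0.
have [w tw] := twist_exists nC k_roots n_gt0 HG.
have [w_dp w_m] := twist_expr_eq1 nC n11 HG a2 am tw.
exists w; split=> // [w_h | g v gC g11 tv wv_h].
  apply: (coboundary2_scaleV (invr_neq0 f11_neq0)).
  exact/(twist_coboundaryE nC n11 k_roots n_gt0 HG tw).
apply: (coboundary2_scaleV (invr_neq0 f11_neq0)).
have := twist_coboundaryE (cocycle2_div nC gC) _ k_roots n_gt0 HG (twist_div tw tv).
rewrite n11 g11 divr1 => /(_ erefl)[_ /(_ wv_h)].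
by apply: coboundary2_eq_in => x y _ _; rewrite mulrA.
Qed.

Lemma Gnam_H2_trivial : (forall w : k, w ^+ dp = 1 -> w ^+ m = 1 -> w ^+ h = 1) ->
  H2_trivial k G.
Proof.
move=> w_h f fC; have [w [w_dp w_m cob _]] := Gnam_class_invariant fC.
exact/cob/w_h.
Qed.

(* Twists are [2 h]-th roots of unity, so [w ^+ h] is [1] or [om ^+ h = -1]. *)
Lemma Gnam_H2_Z2 : 2%:R != 0 :> k -> dp = (2 * h)%N -> (dp %| m)%N -> H2_is_Z2 k G.
Proof.
move=> two_neq0 dp2h dp_m.
have [om om_h] := k_roots (-1) (divn_dminus_gt0 a n_gt0).
have om_dvd q : (dp %| q)%N -> om ^+ q = 1.
  have om_dp : om ^+ dp = 1 by rewrite dp2h mulnC exprM om_h sqrrN expr1n.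
  by case/dvdnP=> r ->; rewrite mulnC exprM om_dp expr1n.
have om_n := om_dvd _ (dvdn_gcdr (a + 1) n); have om_m := om_dvd _ dp_m.
have f0C := Gnam_cocycle_cocycle n_gt0 HG om_n (om_dvd _ (dvdn_gcdl _ _)) om_m.
have f011 := Gnam_cocycle_11 n_gt0 HG om_n om_m.
have tw0 := twist_Gnam_cocycle n_gt0 HG om_n om_m.
exists (Gnam_cocycle t s n om); split=> // [| f fC].
  move/(twist_coboundaryE f0C f011 k_roots n_gt0 HG tw0); rewrite om_h => m1_eq1.
  by apply/(negP two_neq0)/eqP; rewrite mulr2n -{1}m1_eq1 addNr.
have [w [w_dp _ cob coh]] := Gnam_class_invariant fC.
have : (w ^+ h) ^+ 2 == 1 by rewrite -exprM mulnC -dp2h w_dp.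
rewrite sqrf_eq1 => /orP[/eqP w_h | /eqP w_h]; [left; exact: cob | right].
apply: coh f0C f011 tw0 _.
by rewrite expr_div_n w_h om_h divff // oppr_eq0 oner_neq0.
Qed.
End GnamCohomology.

Local Open Scope group_scope.

Theorem proposition4p13 (k : closedFieldType) (gT : finGroupType) (G : {group gT})
    (t s : gT) (n a m : nat) :
  (0 < n)%N ->
  (forall p : nat, p \in [pchar k]%R -> ~~ (p %| 2 * n))%N ->
  (a < n)%N -> (m < n)%N ->
  (a ^ 2 = 1 %[mod n])%N ->
  (a * m = m %[mod n])%N ->
  is_Gnam G t s n a m ->
  let d_minus := gcdn (a + n - 1) n in
  let d_plus := gcdn (a + 1) n in
  ((d_minus * d_plus = n)%N \/ ~ Gnam_split G t -> H2_trivial k G) /\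
  ((d_minus * d_plus = 2 * n)%N /\ Gnam_split G t -> H2_is_Z2 k G).
Proof.
move=> n_gt0 char_k _ _ a2 am HG d_minus d_plus.
have k_roots := @closed_field_root_closed k.
split=> [split_or_prod | [prod /(Gnam_splitP n_gt0 HG) dp_m]].
  apply: (Gnam_H2_trivial n_gt0 HG a2 am k_roots) => w w_dp w_m.
  case: split_or_prod => [prod | /(Gnam_splitP n_gt0 HG) dp_ndvd_m].
    by rewrite (divn_dminus_eq_dplus n_gt0 prod).
  by rewrite -(gcdn_dplus_m n_gt0 a2 am dp_ndvd_m) expr_gcdn_eq1.
apply: (Gnam_H2_Z2 n_gt0 HG a2 am k_roots) => //; last exact: dplus_eq_double n_gt0 prod.
apply/eqP => two_eq0; have /negP[] : ~~ (2 %| 2 * n)%N.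
  by apply: char_k; rewrite inE /= two_eq0 eqxx.
exact: dvdn_mulr.
Qed.
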